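(* Let $\mathcal A:\mathbb R^{n_1\times n_2}\to\mathbb R^m$ be linear and suppose there is $\Delta>0$ such that $\|\mathbf H\|_*\ge\sqrt{m/\Delta}\,\|\mathbf H\|_F$ for all nonzero $\mathbf H\in\mathrm{Null}(\mathcal A)$. Fix $c>0$ and $\alpha>0$. If $m\ge(2+c/\alpha)^2r\Delta$, then every $\mathbf H\in\mathrm{Null}(\mathcal A)$ satisfies $(1+c/\alpha)\sum_{i=1}^r\sigma_i(\mathbf H)\le\sum_{i>r}\sigma_i(\mathbf H)$; consequently every $\mathbf X^0$ of rank at most $r$ with $\|\mathbf X^0\|_2=c$ is the unique solution of problem (N2) with $\mathbf b=\mathcal A(\mathbf X^0)$.
   Context: Problem (N2) is $\min_{\mathbf X}\{\|\mathbf X\|_*+\frac{1}{2\alpha}\|\mathbf X\|_F^2:\ \mathcal A(\mathbf X)=\mathbf b\}$. $\sigma_i(\cdot)$ is the $i$-th largest singular value; $\|\cdot\|_*$, $\|\cdot\|_F$, $\|\cdot\|_2$ are nuclear, Frobenius, spectral norms. *)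

(* Defs.v *)
From HB Require Import structures.
From mathcomp Require Import all_boot all_order all_algebra.
From Stdlib Require Import ClassicalEpsilon.
Set Implicit Arguments. Unset Strict Implicit. Unset Printing Implicit Defensive.
Import Order.TTheory GRing.Theory Num.Theory.
Local Open Scope ring_scope.

Definition orthogonalmx (R : rcfType) (n : nat) (U : 'M[R]_n) : Prop :=
  U *m U^T = 1%:M.

Definition rdiag_mx (R : rcfType) (n1 n2 : nat) (s : nat -> R) : 'M[R]_(n1, n2) :=
  \matrix_(i < n1, j < n2) (if (i : nat) == (j : nat) then s (i : nat) else 0).

(* s (0-indexed: s 0 = sigma_1, s 1 = sigma_2, ...) is the sequence of
   singular values of H: nonnegative, nonincreasing, zero beyond min(n1,n2),
   and H = U diag(s) V^T with U, V orthogonal (an SVD of H). *)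
Definition is_svals (R : rcfType) (n1 n2 : nat) (H : 'M[R]_(n1, n2))
    (s : nat -> R) : Prop :=
  (forall i, 0 <= s i) /\
  (forall i j, (i <= j)%N -> s j <= s i) /\
  (forall i, (minn n1 n2 <= i)%N -> s i = 0) /\
  exists (U : 'M[R]_n1) (V : 'M[R]_n2),
    orthogonalmx U /\ orthogonalmx V /\ H = U *m rdiag_mx n1 n2 s *m V^T.

(* sv H i = sigma_{i+1}(H), the (i+1)-th largest singular value of H
   (chosen by Hilbert's epsilon among singular value sequences; singular
   values are unique and always exist). *)
Definition sv (R : rcfType) (n1 n2 : nat) (H : 'M[R]_(n1, n2)) : nat -> R :=
  epsilon (inhabits (fun _ => 0)) (is_svals H).

Definition nucnorm (R : rcfType) (n1 n2 : nat) (H : 'M[R]_(n1, n2)) : R :=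
  \sum_(i < minn n1 n2) sv H i.

Definition frobnorm (R : rcfType) (n1 n2 : nat) (H : 'M[R]_(n1, n2)) : R :=
  Num.sqrt (\sum_(i < n1) \sum_(j < n2) H i j ^+ 2).

Definition specnorm (R : rcfType) (n1 n2 : nat) (H : 'M[R]_(n1, n2)) : R :=
  sv H 0.

Definition N2obj (R : rcfType) (n1 n2 : nat) (alpha : R) (X : 'M[R]_(n1, n2)) : R :=
  nucnorm X + (2 * alpha)^-1 * frobnorm X ^+ 2.

Definition solves_N2 (R : rcfType) (n1 n2 m : nat)
    (A : {linear 'M[R]_(n1, n2) -> 'cV[R]_m}) (b : 'cV[R]_m) (alpha : R)
    (X : 'M[R]_(n1, n2)) : Prop :=
  A X = b /\ forall Y, A Y = b -> N2obj alpha X <= N2obj alpha Y.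

Definition unique_solution_N2 (R : rcfType) (n1 n2 m : nat)
    (A : {linear 'M[R]_(n1, n2) -> 'cV[R]_m}) (b : 'cV[R]_m) (alpha : R)
    (X : 'M[R]_(n1, n2)) : Prop :=
  solves_N2 A b alpha X /\ forall Y, solves_N2 A b alpha Y -> Y = X.

(* Main.v *)
Require Import Defs.
From HB Require Import structures.
From mathcomp Require Import all_boot all_order all_algebra.
From mathcomp Require Import perm spectral complex ring lra zify.
Set Implicit Arguments. Unset Strict Implicit. Unset Printing Implicit Defensive.
Import Order.TTheory GRing.Theory Num.Theory.
Local Open Scope ring_scope.

(* Write T for the sum of the r largest singular values of H in Null(A). By
   Cauchy-Schwarz T <= sqrt r * |H|_F, so the null space hypothesis gives
   (2 + c/alpha) T <= |H|_*, which is the first claim.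

   For the second, let H = Y - X0 with Y feasible. Mirsky's inequality
   sum_i |sigma_i(X0) - sigma_i(-H)| <= |X0 + H|_* gives
   |Y|_* >= |X0|_* + |H|_* - 2 T, and the trace inequality gives
   <X0, H> >= - c T. Expanding |X0 + H|_F^2, the objective at Y exceeds that
   at X0 by at least |H|_F^2 / (2 alpha).

   Mirsky's inequality is obtained from a symmetric matrix K of trace
   2 |A - B|_* whose quadratic form dominates twice those of the dilations
   [0 A; A^T 0] and [0 B; B^T 0]: by Courant-Fischer, the i-th largest and i-th
   smallest eigenvalues of K are at least 2 max(sigma_i(A), sigma_i(B)) and
   -2 min(sigma_i(A), sigma_i(B)), and one sums over all eigenvalues.

   Over a real closed field there is no compactness, so the spectral theorem
   starts from a complex eigenvalue, shown to be real by symmetry. *)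

(** * Spectral theorem for real symmetric matrices *)

Section Spectral.
Variable R : rcfType.

Definition dotrow n (x y : 'rV[R]_n) : R := (x *m y^T) 0 0.

Lemma dotrowE n (x y : 'rV[R]_n) : dotrow x y = \sum_i x 0 i * y 0 i.
Proof. by rewrite /dotrow mxE; apply: eq_bigr => i _; rewrite mxE. Qed.

Lemma dotrowC n (x y : 'rV[R]_n) : dotrow x y = dotrow y x.
Proof. by rewrite !dotrowE; apply: eq_bigr => i _; rewrite mulrC. Qed.

Lemma dotrowDl n (x y z : 'rV[R]_n) : dotrow (x + y) z = dotrow x z + dotrow y z.
Proof. by rewrite /dotrow mulmxDl mxE. Qed.

Lemma dotrowZl n a (x y : 'rV[R]_n) : dotrow (a *: x) y = a * dotrow x y.
Proof. by rewrite /dotrow -scalemxAl mxE. Qed.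

Lemma dotrowNl n (x y : 'rV[R]_n) : dotrow (- x) y = - dotrow x y.
Proof. by rewrite /dotrow mulNmx mxE. Qed.

Lemma dotrow_mul n m (x : 'rV[R]_n) (A : 'M_(n, m)) y :
  dotrow (x *m A) y = dotrow x (y *m A^T).
Proof. by rewrite /dotrow trmx_mul trmxK mulmxA. Qed.

Lemma dotrow_ge0 n (x : 'rV[R]_n) : 0 <= dotrow x x.
Proof. by rewrite dotrowE sumr_ge0 // => i _; rewrite -expr2 sqr_ge0. Qed.

Lemma dotrow_eq0 n (x : 'rV[R]_n) : (dotrow x x == 0) = (x == 0).
Proof.
apply/idP/eqP => [|->]; last by rewrite /dotrow mul0mx mxE.
rewrite dotrowE psumr_eq0 => [/allP x0|i _]; last by rewrite -expr2 sqr_ge0.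
apply/rowP => i; rewrite mxE; apply/eqP.
by have := x0 i (mem_index_enum _); rewrite /= mulf_eq0 orbb.
Qed.

Lemma dotrow_gt0 n (x : 'rV[R]_n) : (0 < dotrow x x) = (x != 0).
Proof. by rewrite lt_neqAle dotrow_ge0 andbT eq_sym dotrow_eq0. Qed.

Lemma orthogonalmx_tr n (U : 'M[R]_n) : orthogonalmx U -> orthogonalmx U^T.
Proof. by rewrite /orthogonalmx trmxK => /mulmx1C. Qed.

Lemma orthogonalmxM n (U V : 'M[R]_n) :
  orthogonalmx U -> orthogonalmx V -> orthogonalmx (U *m V).
Proof.
rewrite /orthogonalmx => U1 V1.
by rewrite trmx_mul mulmxA -(mulmxA U) V1 mulmx1.
Qed.

Lemma orthogonalmx_block m n (U : 'M[R]_m) (V : 'M[R]_n) :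
  orthogonalmx U -> orthogonalmx V -> orthogonalmx (block_mx U 0 0 V).
Proof.
rewrite /orthogonalmx tr_block_mx !trmx0 mulmx_block => -> ->.
by rewrite !mulmx0 !mul0mx !addr0 !add0r -scalar_mx_block.
Qed.

Lemma dotrow_orth n (U : 'M[R]_n) (x y : 'rV_n) :
  orthogonalmx U -> dotrow (x *m U) (y *m U) = dotrow x y.
Proof. by move=> U1; rewrite dotrow_mul -mulmxA U1 mulmx1. Qed.

(** For a complex eigenvector [x + iy] of eigenvalue [a + ib], real and imaginary parts give
    [xS = ax - by] and [yS = bx + ay]. Symmetry equates [<xS, y>] with [<yS, x>], hence
    [b (|x|^2 + |y|^2) = 0]. So [b = 0], and whichever of [x], [y] is nonzero is a real
    eigenvector. *)
Lemma symmetric_real_eigenvector n (S : 'M[R]_n) : (0 < n)%N -> S^T = S ->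
  exists (a : R) (v : 'rV_n), v *m S = a *: v /\ dotrow v v = 1.
Proof.
move=> n_gt0 Ssym.
suff [a [v [vS v0]]] : exists (a : R) (v : 'rV_n), v *m S = a *: v /\ v != 0.
  have v_gt0 : 0 < dotrow v v by rewrite dotrow_gt0.
  exists a, ((Num.sqrt (dotrow v v))^-1 *: v); split.
    by rewrite -scalemxAl vS !scalerA mulrC.
  rewrite dotrowZl dotrowC dotrowZl mulrA -invfM -expr2 sqr_sqrtr ?ltW //.
  by rewrite mulVf // gt_eqF.
have [[a b] /eigenvalueP [v vS v0]] :=
  eigenvalue_closed (map_mx (real_complex R) S) n_gt0.
pose x : 'rV[R]_n := \row_j complex.Re (v 0 j).
pose y : 'rV[R]_n := \row_j complex.Im (v 0 j).
have Re_sum (F : 'I_n -> R[i]) : complex.Re (\sum_i F i) = \sum_i complex.Re (F i).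
  by apply: big_morph => // -[? ?] [].
have Im_sum (F : 'I_n -> R[i]) : complex.Im (\sum_i F i) = \sum_i complex.Im (F i).
  by apply: big_morph => // -[? ?] [].
have xS : x *m S = a *: x - b *: y.
  apply/rowP => j; move/rowP/(_ j): vS => /(congr1 (@complex.Re R)).
  rewrite !mxE Re_sum => E; transitivity (complex.Re ((a +i* b)%C * v 0 j)).
    rewrite -E; apply: eq_bigr => k _; rewrite !mxE.
    by case: (v 0 k) => p q /=; rewrite mulr0 subr0.
  by case: (v 0 j).
have yS : y *m S = b *: x + a *: y.
  apply/rowP => j; move/rowP/(_ j): vS => /(congr1 (@complex.Im R)).
  rewrite !mxE Im_sum => E; transitivity (complex.Im ((a +i* b)%C * v 0 j)).
    rewrite -E; apply: eq_bigr => k _; rewrite !mxE.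
    by case: (v 0 k) => p q /=; rewrite mulr0 add0r.
  by case: (v 0 j) => p q /=; rewrite addrC.
have xy0 : (x != 0) || (y != 0).
  rewrite -negb_and; apply: contra v0 => /andP[/eqP/rowP x0 /eqP/rowP y0].
  apply/eqP/rowP => j; move: (x0 j) (y0 j); rewrite !mxE.
  by case: (v 0 j) => p q /= -> ->.
have b0 : b = 0.
  have: dotrow (x *m S) y = dotrow (y *m S) x.
    by rewrite dotrow_mul Ssym dotrowC.
  rewrite xS yS !dotrowDl dotrowNl !dotrowZl (dotrowC y x) => E.
  have {}E : b * (dotrow x x + dotrow y y) = 0 by lra.
  move/eqP: E; rewrite mulf_eq0 paddr_eq0 ?dotrow_ge0 // !dotrow_eq0.
  by rewrite -[_ && _]negbK negb_and xy0 orbF => /eqP.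
move: xS yS; rewrite b0 !scale0r subr0 add0r => xS yS.
by case/orP: xy0 => ?; [exists a, x | exists a, y].
Qed.

(* The Householder reflection exchanging the first basis vector and v. *)
Lemma orthogonal_with_first_row n (v : 'rV[R]_n.+1) : dotrow v v = 1 ->
  exists2 Q : 'M_n.+1, orthogonalmx Q & delta_mx 0 0 *m Q = v.
Proof.
move=> v1; set e : 'rV[R]_n.+1 := delta_mx 0 0.
have e1 : dotrow e e = 1.
  by rewrite /dotrow trmx_delta mul_delta_mx mxE !eqxx.
have [->|nve] := eqVneq v e.
  by exists 1%:M; rewrite ?mulmx1 // /orthogonalmx trmx1 mulmx1.
have [w wE] : exists w, w = v - e by eexists.
have w_gt0 : 0 < dotrow w w by rewrite dotrow_gt0 wE subr_eq0.
pose k := 2 / dotrow w w.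
have kw : k * dotrow w w = 2 by rewrite divfK // gt_eqF.
have wwE : w *m w^T = (dotrow w w)%:M by rewrite [LHS]mx11_scalar.
have tr_refl : (1%:M - k *: (w^T *m w))^T = 1%:M - k *: (w^T *m w).
  by rewrite raddfB /= trmx1 linearZ /= trmx_mul trmxK.
exists (1%:M - k *: (w^T *m w)).
  rewrite /orthogonalmx tr_refl.
  have PP : (w^T *m w) *m (w^T *m w) = dotrow w w *: (w^T *m w).
    by rewrite -mulmxA (mulmxA w) wwE mul_scalar_mx -scalemxAr.
  rewrite mulmxBl mul1mx mulmxBr mulmx1 -scalemxAl -scalemxAr PP !scalerA.
  rewrite -mulrA kw -scalerBl -addrA -opprD -scalerDl.
  by rewrite (_ : k + (k - k * 2) = 0) ?scale0r ?subr0 //; ring.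
(* As [v] and [e] are both unit vectors, [<e, v - e> = -|v - e|^2 / 2]; the reflection therefore
   sends [e] to [e + w = v]. *)
have ewE : e *m w^T = (- (dotrow w w / 2))%:M.
  rewrite [LHS]mx11_scalar -/(dotrow e w); congr (_%:M).
  rewrite wE !(dotrowDl, dotrowNl) ![dotrow _ (v - e)]dotrowC !(dotrowDl, dotrowNl).
  by rewrite v1 e1 (dotrowC v e); field.
rewrite mulmxBr mulmx1 -scalemxAr mulmxA ewE mul_scalar_mx scalerA.
rewrite mulrN mulrA kw divff ?pnatr_eq0 // scaleN1r opprK.
by rewrite wE addrC subrK.
Qed.

(** Deflation: in an orthonormal basis starting with a unit eigenvector, the first row of [S] is [a]
    followed by zeros, by symmetry so is the first column, and induction applies to the remaining
    block. *)
Lemma symmetric_diagonalizable n (S : 'M[R]_n) : S^T = S ->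
  exists (U : 'M_n) (d : 'rV_n), orthogonalmx U /\ S = U *m diag_mx d *m U^T.
Proof.
elim: n S => [|n IHn] S Ssym.
  exists 1%:M, 0; rewrite /orthogonalmx trmx1 mulmx1; split=> //.
  by rewrite [LHS]flatmx0 [RHS]flatmx0.
have [a [v [vS /orthogonal_with_first_row [Q Q1 Qv]]]] :=
  symmetric_real_eigenvector (ltn0Sn n) Ssym.
have [T TQ] : exists T : 'M[R]_(1 + n), T = Q *m S *m Q^T by eexists.
have Tsym : T^T = T by rewrite TQ !trmx_mul trmxK Ssym mulmxA.
have T0 : delta_mx 0 0 *m T = a *: (delta_mx 0 0 : 'rV[R]_(1 + n)).
  by rewrite TQ !mulmxA Qv vS -scalemxAl -Qv -mulmxA Q1 mulmx1.
have TE i : T 0 i = a *+ (i == 0).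
  move/rowP/(_ i): T0; rewrite -rowE !mxE => ->.
  by rewrite eqxx /= mulr_natr.
have ur0 : ursubmx T = 0.
  by apply/matrixP => i j; rewrite !mxE ord1 lshift0 TE -val_eqE.
have dl0 : dlsubmx T = 0.
  by rewrite -[LHS]trmxK trmx_dlsub Tsym ur0 trmx0.
have ulE : ulsubmx T = a%:M.
  by apply/matrixP => i j; rewrite !ord1 !mxE lshift0 TE eqxx.
have [|U' [d' [U1 dE]]] := IHn (drsubmx T); first by rewrite trmx_drsub Tsym.
have [W WE] : exists W : 'M_(1 + n), W = block_mx 1%:M 0 0 U' by eexists.
have W1 : orthogonalmx W.
  by rewrite WE; apply: orthogonalmx_block; rewrite // /orthogonalmx trmx1 mulmx1.
have TW : T = W *m diag_mx (row_mx a%:M d') *m W^T.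
  rewrite WE diag_mx_row tr_block_mx !trmx0 trmx1 !mulmx_block.
  rewrite !mulmx0 !mul0mx !mulmx1 !mul1mx !addr0 !add0r -dE.
  have -> : diag_mx a%:M = a%:M :> 'M[R]_1.
    by apply/matrixP => i j; rewrite !ord1 !mxE.
  by rewrite -[LHS]submxK ulE ur0 dl0 mul0mx.
exists (Q^T *m W), (row_mx a%:M d'); split.
  by apply: orthogonalmxM => //; apply: orthogonalmx_tr.
have QtQ := mulmx1C Q1.
rewrite trmx_mul trmxK mulmxA -[_ *m _ *m W^T]mulmxA -(mulmxA Q^T) (mulmxA W) -TW TQ.
by rewrite !mulmxA QtQ mul1mx -mulmxA QtQ mulmx1.
Qed.

Lemma symmetric_sorted_diagonalizable n (S : 'M[R]_n) : S^T = S ->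
  exists (U : 'M_n) (d : 'rV_n), [/\ orthogonalmx U,
    S = U *m diag_mx d *m U^T & forall i j : 'I_n, (i <= j)%N -> d 0 j <= d 0 i].
Proof.
move=> /symmetric_diagonalizable [U [d [U1 ->]]].
pose t := [tuple d 0 i | i < n].
have szs : size (sort >=%R t) == n by rewrite size_sort size_tuple.
have [p pE] : exists p : 'S_n, sort >=%R t = [tuple tnth t (p i) | i < n].
  by apply/tuple_permP; rewrite perm_sort.
(* Arbitrary weights [e] serve twice: [e = 1] gives orthogonality of the permuted [U], and [e = d]
   gives the factorization of [S]. *)
have permE e : col_perm p U *m diag_mx (\row_i e (p i)) *m (col_perm p U)^T =
    U *m diag_mx (\row_i e i) *m U^T.
  apply/matrixP => i j; rewrite !mul_mx_diag !mxE.
  rewrite [RHS](reindex_inj (@perm_inj _ p)) /=.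
  by apply: eq_bigr => k _; rewrite !mxE.
have diag1 f : (forall i : 'I_n, f i = 1 :> R) -> diag_mx (\row_i f i) = 1%:M.
  by move=> f1; apply/matrixP => i j; rewrite !mxE f1.
exists (col_perm p U), (\row_i d 0 (p i)); split.
- have := permE (fun _ => 1); rewrite !diag1 // !mulmx1 => E.
  by rewrite /orthogonalmx E.
- rewrite (permE (d 0)); congr (_ *m diag_mx _ *m _).
  by apply/rowP => i; rewrite mxE.
move=> i j le_ij; rewrite !mxE.
have nthE (k : 'I_n) : nth 0 (sort >=%R t) k = d 0 (p k).
  by rewrite pE -tnth_nth !tnth_mktuple.
rewrite -!nthE.
apply: (sorted_leq_nth (leT := fun x y => y <= x)) => //.
- by move=> x y z /[swap]; apply: le_trans.
- by apply: sort_sorted => x y; apply: le_total.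
- by rewrite inE (eqP szs).
- by rewrite inE (eqP szs).
Qed.
End Spectral.

(** * Singular value decomposition *)

Section SVD.
Variable R : rcfType.

Lemma dotrow_diag n (U : 'M[R]_n) (d x : 'rV_n) :
  dotrow (x *m (U *m diag_mx d *m U^T)) x = \sum_i d 0 i * (x *m U) 0 i ^+ 2.
Proof.
rewrite !mulmxA dotrow_mul trmxK dotrowE; apply: eq_bigr => i _.
rewrite mul_mx_diag mxE; ring.
Qed.

(** The maximum of the Rayleigh quotient, attained without compactness: it is the first entry of the
    sorted spectrum. *)
Lemma symmetric_max_eigenvector n (S : 'M[R]_n.+1) : S^T = S ->
  exists (a : R) (v : 'rV_n.+1), [/\ v *m S = a *: v, dotrow v v = 1 &
    forall x, dotrow (x *m S) x <= a * dotrow x x].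
Proof.
move=> /symmetric_sorted_diagonalizable [U [d [U1 -> dS]]].
exists (d 0 0), (delta_mx 0 0 *m U^T); split.
- rewrite !mulmxA -(mulmxA _ U^T) (mulmx1C U1) mulmx1 scalemxAl; congr (_ *m _).
  by apply/rowP => j; rewrite mul_mx_diag !mxE eqxx /=; have [->|_] := eqVneq j 0;
    rewrite ?mulr0 ?mul0r // mulrC.
- rewrite dotrow_orth; last exact: orthogonalmx_tr.
  by rewrite /dotrow trmx_delta mul_delta_mx mxE !eqxx.
move=> x; rewrite dotrow_diag -(dotrow_orth x x U1) dotrowE mulr_sumr.
by apply: ler_sum => i _; rewrite expr2 ler_wpM2r ?dS // -expr2 sqr_ge0.
Qed.

Lemma is_svals0 n1 n2 : is_svals (0 : 'M[R]_(n1, n2)) (fun _ => 0).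
Proof.
split=> //; split=> //; split=> //; exists 1%:M, 1%:M.
rewrite /orthogonalmx !trmx1 !mulmx1; split=> //; split=> //.
by rewrite mul1mx; apply/matrixP => i j; rewrite !mxE if_same.
Qed.

(** The bound is tested on the first left singular vector, where [|xG|^2] equals [s 0 ^+ 2]. *)
Lemma svals_head_le n1 n2 (G : 'M[R]_(n1, n2)) (s : nat -> R) (b : R) : 0 <= b ->
  is_svals G s -> (forall x, dotrow (x *m G) (x *m G) <= b * dotrow x x) ->
  s 0 ^+ 2 <= b.
Proof.
move=> b0 [_ [_ [s0 [U [V [U1 [V1 ->]]]]]]].
(* With an empty dimension there is no such vector, but then [s 0 = 0] and [0 <= b] suffices. *)
case: n1 n2 s0 U V U1 V1 {G} => [|n1] [|n2] s0 U V U1 V1;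
  try by rewrite s0 // expr2 mulr0.
move=> /(_ (delta_mx 0 0 *m U^T)).
have -> : (delta_mx 0 0 : 'rV_n1.+1) *m U^T *m (U *m rdiag_mx n1.+1 n2.+1 s *m V^T) =
    s 0 *: delta_mx 0 0 *m V^T.
  rewrite !mulmxA -(mulmxA _ U^T) (mulmx1C U1) mulmx1; congr (_ *m _).
  apply/rowP => j; rewrite -rowE !mxE /= -val_eqE eq_sym /=.
  by case: eqP => _; rewrite ?mulr1 ?mulr0.
rewrite !dotrow_orth; try exact: orthogonalmx_tr.
rewrite dotrowZl dotrowC dotrowZl /dotrow !trmx_delta !mul_delta_mx !mxE !eqxx.
by rewrite !mulr1 -expr2.
Qed.

Lemma dotrow_row_mx m n (x x' : 'rV[R]_m) (y y' : 'rV[R]_n) :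
  dotrow (row_mx x y) (row_mx x' y') = dotrow x x' + dotrow y y'.
Proof. by rewrite /dotrow tr_row_mx mul_row_col mxE. Qed.

(** Induction on the number of rows. A top unit eigenvector [v] of [H H^T], with eigenvalue
    [a = g^2], is paired with [w = vH / g]. Rotating [v] and [w] to the first basis vectors leaves
    [g] in the corner, zeros beside and below it, and a smaller block. *)
Lemma svals_exist n1 n2 (H : 'M[R]_(n1, n2)) : exists s, is_svals H s.
Proof.
elim: n1 n2 H => [|n1 IHn] n2 H.
  by exists (fun _ => 0); rewrite flatmx0; apply: is_svals0.
case: n2 H => [|n2] H.
  by exists (fun _ => 0); rewrite thinmx0; apply: is_svals0.
have [|a [v [vS v1 amax]]] := @symmetric_max_eigenvector _ (H *m H^T).
  by rewrite trmx_mul trmxK.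
have Hle x : dotrow (x *m H) (x *m H) <= a * dotrow x x.
  by rewrite -(trmxK H) -dotrow_mul trmxK -mulmxA.
have aE : a = dotrow (v *m H) (v *m H).
  by rewrite -[in RHS](trmxK H) -dotrow_mul trmxK -mulmxA vS dotrowZl v1 mulr1.
have a0 : 0 <= a by rewrite aE dotrow_ge0.
(* If the top eigenvalue is zero, the Rayleigh bound makes every row of [H] vanish. *)
have [az|anz] := eqVneq a 0.
  suff -> : H = 0 by exists (fun _ => 0); apply: is_svals0.
  apply/row_matrixP => i; rewrite row0 rowE; apply/eqP; rewrite -dotrow_eq0.
  rewrite eq_le dotrow_ge0 andbT.
  by apply: le_trans (Hle _) _; rewrite az mul0r.
have [g g_gt0 gg] : exists2 g : R, 0 < g & g * g = a.
  exists (Num.sqrt a); last by rewrite -expr2 sqr_sqrtr.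
  by rewrite sqrtr_gt0 lt_neqAle eq_sym anz.
have gnz : g != 0 by rewrite gt_eqF.
have [w wE] : exists w : 'rV_n2.+1, w = g^-1 *: (v *m H) by eexists.
have w1 : dotrow w w = 1.
  by rewrite wE dotrowZl dotrowC dotrowZl -aE -gg; field.
have vH : v *m H = g *: w by rewrite wE scalerA mulfV // scale1r.
have wH : w *m H^T = g *: v.
  by rewrite wE -scalemxAl -mulmxA vS scalerA -gg mulKf.
have [P P1 Pv] := orthogonal_with_first_row v1.
have [Q Q1 Qw] := orthogonal_with_first_row w1.
have [G GE] : exists G : 'M_(1 + n1, 1 + n2), G = P *m H *m Q^T by eexists.
have G0 : delta_mx 0 0 *m G = g *: (delta_mx 0 0 : 'rV_(1 + n2)).
  by rewrite GE !mulmxA Pv vH -scalemxAl -Qw -mulmxA Q1 mulmx1.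
have Gt0 : delta_mx 0 0 *m G^T = g *: (delta_mx 0 0 : 'rV_(1 + n1)).
  by rewrite GE !trmx_mul trmxK !mulmxA Qw wH -scalemxAl -Pv -mulmxA P1 mulmx1.
have GrE i : G 0 i = g *+ (i == 0).
  by move/rowP/(_ i): G0; rewrite -rowE !mxE => ->; rewrite eqxx mulr_natr.
have GcE i : G i 0 = g *+ (i == 0).
  by move/rowP/(_ i): Gt0; rewrite -rowE !mxE => ->; rewrite eqxx mulr_natr.
have ur0 : ursubmx G = 0.
  by apply/matrixP => i j; rewrite !mxE ord1 lshift0 GrE -val_eqE.
have dl0 : dlsubmx G = 0.
  by apply/matrixP => i j; rewrite !mxE ord1 lshift0 GcE -val_eqE.
have ulE : ulsubmx G = g%:M.
  by apply/matrixP => i j; rewrite !ord1 !mxE lshift0 GrE eqxx.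
have [t tG] := IHn _ (drsubmx G).
have GB : G = block_mx g%:M 0 0 (drsubmx G) by rewrite -[LHS]submxK ulE ur0 dl0.
(* The smaller block inherits the norm bound of [H], so its largest singular value is at most [g]
   and prepending [g] keeps the sequence nonincreasing. *)
have Gle x : dotrow (x *m drsubmx G) (x *m drsubmx G) <= a * dotrow x x.
  have row0K k (y : 'rV[R]_k) :
      @dotrow R k.+1 (row_mx (0 : 'rV_1) y) (row_mx (0 : 'rV_1) y) = dotrow y y.
    by rewrite [LHS](dotrow_row_mx (0 : 'rV_1) 0) {1}/dotrow mul0mx mxE add0r.
  have xG : (row_mx (0 : 'rV_1) x *m P *m H) *m Q^T = row_mx (0 : 'rV_1) (x *m drsubmx G).
    transitivity (row_mx (0 : 'rV_1) x *m G); first by rewrite GE !mulmxA.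
    by rewrite {1}GB mul_row_block !mul0mx mulmx0 !add0r.
  have := Hle (row_mx (0 : 'rV_1) x *m P).
  rewrite dotrow_orth // row0K -(dotrow_orth _ _ (orthogonalmx_tr Q1)).
  by rewrite xG row0K.
have t0g : t 0 <= g.
  have := svals_head_le a0 tG Gle; rewrite -gg -expr2 ler_sqr // nnegrE.
    by case: tG.
  exact: ltW.
case: tG => t_ge0 [t_dec [t_end [U [V [U1 [V1 GdE]]]]]].
exists (fun k => if k is k'.+1 then t k' else g); split; first by case=> // ; apply: ltW.
split.
  case=> [|i] [|j] //= ij; last exact: t_dec.
  by apply: le_trans t0g; apply: t_dec.
split; first by case=> [|i]; rewrite minnSS // => /t_end.
have [U' U'E] : exists U' : 'M[R]_(1 + n1), U' = block_mx 1%:M 0 0 U by eexists.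
have [V' V'E] : exists V' : 'M[R]_(1 + n2), V' = block_mx 1%:M 0 0 V by eexists.
have U'1 : orthogonalmx U'.
  by rewrite U'E; apply: orthogonalmx_block; rewrite // /orthogonalmx trmx1 mulmx1.
have V'1 : orthogonalmx V'.
  by rewrite V'E; apply: orthogonalmx_block; rewrite // /orthogonalmx trmx1 mulmx1.
set s := fun k : nat => _.
have GUV : G = U' *m rdiag_mx (1 + n1) (1 + n2) s *m V'^T.
  have -> : rdiag_mx (1 + n1) (1 + n2) s = block_mx g%:M 0 0 (rdiag_mx n1 n2 t).
    rewrite -[LHS]submxK; congr block_mx; apply/matrixP => i j;
      by rewrite !mxE ?ord1.
  rewrite U'E V'E tr_block_mx !trmx0 trmx1 !mulmx_block.
  by rewrite !mulmx0 !mul0mx !mulmx1 !mul1mx !addr0 !add0r mul0mx -GdE.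
exists (P^T *m U'), (Q^T *m V'); split.
  by apply: orthogonalmxM => //; apply: orthogonalmx_tr.
split; first by apply: orthogonalmxM => //; apply: orthogonalmx_tr.
rewrite trmx_mul trmxK mulmxA -[_ *m _ *m V'^T]mulmxA -(mulmxA P^T) (mulmxA U') -GUV GE.
by rewrite !mulmxA (mulmx1C P1) mul1mx -mulmxA (mulmx1C Q1) mulmx1.
Qed.

Lemma svP n1 n2 (H : 'M[R]_(n1, n2)) : is_svals H (sv H).
Proof. exact: ClassicalEpsilon.epsilon_spec (svals_exist H). Qed.

End SVD.

(** * Coordinates and eigenvalue bounds *)

Section Coordinates.
Variable R : rcfType.

(** Coordinates are extended by zero to all natural indices, so that vectors of different lengths
    can be summed over a common range. *)
Definition coef n (x : 'rV[R]_n) (a : nat) : R :=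
  if insub a is Some i then x 0 i else 0.

Lemma coef_ord n (x : 'rV_n) (i : 'I_n) : coef x i = x 0 i.
Proof. by rewrite /coef valK. Qed.

Lemma coef_lt n (x : 'rV_n) a (an : (a < n)%N) : coef x a = x 0 (Ordinal an).
Proof. exact: (coef_ord x (Ordinal an)). Qed.

Lemma coef_default n (x : 'rV_n) a : (n <= a)%N -> coef x a = 0.
Proof. by move=> na; rewrite /coef insubF // ltnNge na. Qed.

Lemma sum_minn m n (F : nat -> R) : (forall a, (n <= a)%N -> F a = 0) ->
  \sum_(a < m) F a = \sum_(a < minn m n) F a.
Proof.
move=> F0; rewrite [RHS](big_ord_widen_cond m xpredT F) ?geq_minl //= [RHS]big_mkcond.
apply: eq_bigr => a _; case: ltnP => //; rewrite geq_min leqNgt ltn_ord /=.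
exact: F0.
Qed.

Lemma sum_extend m n (F : nat -> R) : (m <= n)%N ->
  (forall a, (m <= a)%N -> F a = 0) -> \sum_(a < n) F a = \sum_(a < m) F a.
Proof. by move=> /minn_idPr mn F0; rewrite (@sum_minn n m) // mn. Qed.

Lemma dotrow_coef n (x y : 'rV[R]_n) : dotrow x y = \sum_(a < n) coef x a * coef y a.
Proof. by rewrite dotrowE; apply: eq_bigr => i _; rewrite !coef_ord. Qed.

Lemma coef_mul_rdiag m n (x : 'rV[R]_m) (s : nat -> R) a : (a < n)%N ->
  coef (x *m rdiag_mx m n s) a = coef x a * s a.
Proof.
move=> an; rewrite coef_lt mxE /=.
have [am|ma] := ltnP a m.
  rewrite (bigD1 (Ordinal am)) //= mxE /= eqxx big1 ?addr0.
    by rewrite coef_lt.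
  by move=> i; rewrite -val_eqE /= mxE /= => /negPf ->; rewrite mulr0.
rewrite coef_default // mul0r big1 // => i _; rewrite mxE /=.
by case: eqP => [ia|]; rewrite ?mulr0 //; have := ltn_ord i; rewrite ia ltnNge ma.
Qed.

Lemma dotrow_rdiag m n (x : 'rV[R]_m) (s : nat -> R) (y : 'rV_n) :
  dotrow (x *m rdiag_mx m n s) y =
  \sum_(a < minn m n) s a * (coef x a * coef y a).
Proof.
rewrite dotrow_coef minnC -(@sum_minn n m (fun a => s a * (coef x a * coef y a))).
  by apply: eq_bigr => a _; rewrite coef_mul_rdiag //; ring.
by move=> a ma; rewrite coef_default // mul0r mulr0.
Qed.

Lemma dotrow_svd m n (H : 'M[R]_(m, n)) s U V (x : 'rV_m) (y : 'rV_n) :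
  H = U *m rdiag_mx m n s *m V^T ->
  dotrow (x *m H) y =
  \sum_(a < minn m n) s a * (coef (x *m U) a * coef (y *m V) a).
Proof. by move=> ->; rewrite !mulmxA dotrow_mul trmxK dotrow_rdiag. Qed.

(** Max-min half of Courant-Fischer. The row space of [E] has dimension [k > j], so it contains a
    nonzero vector orthogonal to the first [j] eigenvectors; there the quadratic form is at most
    [d 0 j] times the squared norm. *)
Lemma eigenvalue_ge_of_subspace N k (U : 'M[R]_N) (d : 'rV_N) (E : 'M_(k, N))
    (e : R) (j : 'I_N) :
  orthogonalmx U -> (forall i l : 'I_N, (i <= l)%N -> d 0 l <= d 0 i) ->
  (forall y : 'rV_k, y *m E = 0 -> y = 0) ->
  (forall y : 'rV_k, e * dotrow (y *m E) (y *m E) <=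
     dotrow (y *m E *m (U *m diag_mx d *m U^T)) (y *m E)) ->
  (j < k)%N -> e <= d 0 j.
Proof.
move=> U1 dS Efree Ele jk.
(* [G] extracts the first [j] eigencoordinates of [y *m E]. Having more rows than columns, it kills
   some nonzero [y]. *)
pose G : 'M_(k, j) := E *m U *m rdiag_mx N j (fun => 1).
have /rowV0Pn [y /sub_kermxP yG y0] : kermx G != 0.
  by rewrite kermx_eq0 /row_free neq_ltn (leq_ltn_trans (rank_leq_col _)).
set x := y *m E; have x_gt0 : 0 < dotrow x x.
  by rewrite dotrow_gt0; apply: contra_neq y0 => /Efree.
have xU0 (i : 'I_N) : (i < j)%N -> (x *m U) 0 i = 0.
  move=> ij; have := @coef_mul_rdiag _ _ (x *m U) (fun => 1) i ij.
  rewrite mulr1 coef_ord => <-; rewrite coef_lt.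
  by rewrite /x -!mulmxA (mulmxA E) yG mxE.
rewrite -(ler_pM2r x_gt0); apply: le_trans (Ele y) _.
rewrite dotrow_diag -(dotrow_orth x x U1) dotrowE mulr_sumr.
apply: ler_sum => i _; have [ij|ji] := ltnP i j.
  by rewrite xU0 // expr2 !mulr0.
by rewrite expr2 ler_wpM2r ?dS // -expr2 sqr_ge0.
Qed.

(** Dual form: [i] linear constraints leave a subspace of dimension at least [N - i > j]. *)
Lemma eigenvalue_ge_of_constraints N i (U : 'M[R]_N) (d : 'rV_N) (C : 'M_(N, i))
    (e : R) (j : 'I_N) :
  orthogonalmx U -> (forall i l : 'I_N, (i <= l)%N -> d 0 l <= d 0 i) ->
  (forall x : 'rV_N, x *m C = 0 ->
     e * dotrow x x <= dotrow (x *m (U *m diag_mx d *m U^T)) x) ->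
  (j + i < N)%N -> e <= d 0 j.
Proof.
move=> U1 dS Cle jiN.
apply: (@eigenvalue_ge_of_subspace _ _ U _ (row_base (kermx C))) => //.
- move=> y yK; apply: (row_free_inj (row_base_free (kermx C))).
  by rewrite yK mul0mx.
- move=> y; apply: Cle; apply/sub_kermxP.
  by apply: submx_trans (submxMl _ _) _; rewrite eq_row_base.
by have := rank_leq_col C; rewrite mxrank_ker; lia.
Qed.

End Coordinates.

(** * Mirsky's inequality *)

Section Mirsky.
Variables (R : rcfType) (n1 n2 : nat).
Local Notation p := (minn n1 n2).
Local Notation N := (n1 + n2)%N.

(** The test space, of dimension [i + 1], pairs combinations of the first [i + 1] left singular
    vectors with the same combinations of right ones. There [4 <xA, z>] is at least
    [4 s_i |y|^2 = 2 s_i (|x|^2 + |z|^2)], where [y] holds the common coefficients. *)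
Lemma dilation_eigenvalue_ge (K : 'M[R]_N) (A : 'M[R]_(n1, n2)) (s : nat -> R)
    (U : 'M_N) (d : 'rV_N) (i : nat) :
  orthogonalmx U -> K = U *m diag_mx d *m U^T ->
  (forall j l : 'I_N, (j <= l)%N -> d 0 l <= d 0 j) ->
  (forall (x : 'rV_n1) (y : 'rV_n2), 4 * dotrow (x *m A) y <=
     dotrow (row_mx x y *m K) (row_mx x y)) ->
  is_svals A s -> (i < p)%N -> 2 * s i <= coef d i.
Proof.
move=> U1 KE dS AK [s0 [sdec [send [P [Q [P1 [Q1 AE]]]]]]] ip.
have [i1 i2] : (i < n1 /\ i < n2)%N by lia.
have iN : (i < N)%N by lia.
rewrite (coef_lt _ iN).
have sum_trunc n (y : 'rV[R]_i.+1) : (i.+1 <= n)%N ->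
    \sum_(a < n) coef (y *m rdiag_mx i.+1 n (fun => 1)) a ^+ 2 = dotrow y y.
  move=> le_in; rewrite dotrow_coef -(@sum_extend _ i.+1 n (fun a => coef y a * coef y a)) //.
    by apply: eq_bigr => a _; rewrite coef_mul_rdiag // mulr1 expr2.
  by move=> a ia; rewrite coef_default // mul0r.
pose x (y : 'rV[R]_i.+1) := y *m rdiag_mx i.+1 n1 (fun => 1) *m P^T.
pose z (y : 'rV[R]_i.+1) := y *m rdiag_mx i.+1 n2 (fun => 1) *m Q^T.
pose E : 'M[R]_(i.+1, N) := row_mx (rdiag_mx i.+1 n1 (fun => 1) *m P^T)
                              (rdiag_mx i.+1 n2 (fun => 1) *m Q^T).
have yE y : y *m E = row_mx (x y) (z y) by rewrite mul_mx_row !mulmxA.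
have xx y : dotrow (x y) (x y) = dotrow y y.
  rewrite /x dotrow_orth; last exact: orthogonalmx_tr.
  by rewrite dotrow_coef -(sum_trunc n1) //; apply: eq_bigr => a _; rewrite expr2.
have zz y : dotrow (z y) (z y) = dotrow y y.
  rewrite /z dotrow_orth; last exact: orthogonalmx_tr.
  by rewrite dotrow_coef -(sum_trunc n2) //; apply: eq_bigr => a _; rewrite expr2.
apply: (@eigenvalue_ge_of_subspace _ _ i.+1 U d E) => //.
  move=> y; rewrite yE => yE0; apply/eqP; rewrite -dotrow_eq0 -xx.
  have -> : x y = lsubmx (row_mx (x y) (z y)) by rewrite row_mxKl.
  by rewrite yE0 linear0 dotrow_eq0.
move=> y; rewrite yE -KE; apply: le_trans (AK _ _).
rewrite dotrow_row_mx xx zz (dotrow_svd _ _ AE) /x /z.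
rewrite -!(mulmxA _ P^T) -!(mulmxA _ Q^T) !(mulmx1C P1) !(mulmx1C Q1) !mulmx1.
have -> : 2 * s i * (dotrow y y + dotrow y y) = 4 * (s i * dotrow y y) by ring.
rewrite ler_pM2l // -(sum_trunc p) // mulr_sumr; apply: ler_sum => a _.
have [a1 a2] : (a < n1 /\ a < n2)%N by have := ltn_ord a; lia.
rewrite !coef_mul_rdiag // !mulr1 -expr2.
have [ai|ia] := leqP a i; first by rewrite ler_wpM2r ?sqr_ge0 ?sdec.
by rewrite coef_default // expr2 !mulr0.
Qed.

(** The [i] constraints make the first [i] singular coordinates of [x] and [y] agree. The
    corresponding terms of [4 <xA, y>] are then nonnegative, and each later one is at least [-2 s_i]
    times the sum of the two squared coordinates. The case [i = p], where [s p = 0], is allowed. *)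
Lemma dilation_eigenvalue_geN (K : 'M[R]_N) (A : 'M[R]_(n1, n2)) (s : nat -> R)
    (U : 'M_N) (d : 'rV_N) (i j : nat) :
  orthogonalmx U -> K = U *m diag_mx d *m U^T ->
  (forall j l : 'I_N, (j <= l)%N -> d 0 l <= d 0 j) ->
  (forall (x : 'rV_n1) (y : 'rV_n2), 4 * dotrow (x *m A) y <=
     dotrow (row_mx x y *m K) (row_mx x y)) ->
  is_svals A s -> (i <= p)%N -> (j + i < N)%N -> - (2 * s i) <= coef d j.
Proof.
move=> U1 KE dS AK [s0 [sdec [send [P [Q [P1 [Q1 AE]]]]]]] ip jiN.
have jN : (j < N)%N by lia.
have [i1 i2] : (i <= n1 /\ i <= n2)%N by lia.
rewrite (coef_lt _ jN).
pose C : 'M[R]_(N, i) := col_mx (P *m rdiag_mx n1 i (fun => 1))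
                                (- (Q *m rdiag_mx n2 i (fun => 1))).
apply: (@eigenvalue_ge_of_constraints _ _ i U d C) => // v.
rewrite -(hsubmxK v); move: (lsubmx v) (rsubmx v) => x y {v}.
rewrite -KE mul_row_col mulmxN => /eqP; rewrite subr_eq0 !mulmxA => /eqP xyC.
apply: le_trans (AK _ _).
have xy a : (a < i)%N -> coef (x *m P) a = coef (y *m Q) a.
  move=> ai; have := congr1 (fun u => coef u a) xyC.
  by rewrite !coef_mul_rdiag // !mulr1.
rewrite dotrow_row_mx (dotrow_svd _ _ AE) -(dotrow_orth x x P1) -(dotrow_orth y y Q1).
rewrite !dotrow_coef.
move: (x *m P) (y *m Q) xy => {xyC}x' y' xy.
have le_trunc n (q : 'rV[R]_n) : (p <= n)%N ->
    \sum_(a < p) coef q a ^+ 2 <= \sum_(a < n) coef q a * coef q a.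
  move=> pn; rewrite (big_ord_widen_cond n xpredT (fun a => coef q a ^+ 2)) //=.
  rewrite big_mkcond; apply: ler_sum => a _.
  by case: ifP => _; rewrite -expr2 // sqr_ge0.
have s_i := s0 i.
apply: (@le_trans _ _ (- (2 * s i) *
    (\sum_(a < p) coef x' a ^+ 2 + \sum_(a < p) coef y' a ^+ 2))).
  rewrite ler_wnM2l ?oppr_le0 ?mulr_ge0 // lerD ?le_trunc //; lia.
rewrite -big_split !mulr_sumr; apply: ler_sum => a _ /=.
have [ai|ia] := ltnP a i.
  rewrite xy //.
  have := s0 a; have := sqr_ge0 (coef y' a); nra.
have := sdec _ _ ia; have := s0 a.
have := sqr_ge0 (coef x' a + coef y' a).
have := sqr_ge0 (coef x' a); have := sqr_ge0 (coef y' a).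
move: (coef x' a) (coef y' a) (s a) (s i) s_i => X Y sa si h1 h2 h3 h4 h5 h6.
(* Certificate: [4 sa X Y + 2 si (X^2 + Y^2)] is twice the sum of this product and the next. *)
have : 0 <= sa * (X + Y) ^+ 2 by apply: mulr_ge0.
have : 0 <= (si - sa) * (X ^+ 2 + Y ^+ 2) by rewrite mulr_ge0 ?subr_ge0 ?addr_ge0.
nra.
Qed.

(* Twice the positive part of the Hermitian dilation of A - B = W diag(t) Z^T,
   plus twice the dilation of B; it is symmetric in A and B. *)
Definition mirsky_mx (A B : 'M[R]_(n1, n2)) (W : 'M_n1) (Z : 'M_n2)
    (t : nat -> R) : 'M[R]_N :=
  block_mx (W *m rdiag_mx n1 n1 t *m W^T) (A + B)
           (A + B)^T (Z *m rdiag_mx n2 n2 t *m Z^T).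

(** Replacing [W] by [- W] turns a decomposition of [A - B] into one of [B - A] without changing the
    diagonal blocks, so one matrix dominates both dilations. *)
Lemma mirsky_mxC A B W Z t : mirsky_mx A B W Z t = mirsky_mx B A (- W) Z t.
Proof.
by rewrite /mirsky_mx (addrC A) linearN /= !mulNmx mulmxN opprK.
Qed.

Lemma rdiag_mx_tr m n (s : nat -> R) : (rdiag_mx m n s)^T = rdiag_mx n m s.
Proof.
by apply/matrixP => i j; rewrite !mxE eq_sym; case: eqP => // ->.
Qed.

Lemma mirsky_mx_sym A B W Z t : (mirsky_mx A B W Z t)^T = mirsky_mx A B W Z t.
Proof. by rewrite tr_block_mx !trmx_mul !trmxK !rdiag_mx_tr !mulmxA. Qed.

Lemma tr_conj_rdiag n (W : 'M[R]_n) (t : nat -> R) : orthogonalmx W ->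
  \tr (W *m rdiag_mx n n t *m W^T) = \sum_(a < n) t a.
Proof.
move=> W1; rewrite mxtrace_mulC mulmxA (mulmx1C W1) mul1mx.
by apply: eq_bigr => a _; rewrite mxE eqxx.
Qed.

(** Completing the square: the difference of the two sides is the sum of
    [t_a ((xW)_a - (yZ)_a)^2]. *)
Lemma mirsky_form_ge A B W Z t : (forall a, 0 <= t a) ->
  (forall a, (p <= a)%N -> t a = 0) -> A - B = W *m rdiag_mx n1 n2 t *m Z^T ->
  forall (x : 'rV_n1) (y : 'rV_n2), 4 * dotrow (x *m A) y <=
    dotrow (row_mx x y *m mirsky_mx A B W Z t) (row_mx x y).
Proof.
move=> t0 tend ABE x y.
rewrite mul_row_block dotrow_row_mx !dotrowDl (dotrow_svd x x erefl).
rewrite (dotrow_svd y y erefl) (dotrow_mul y) trmxK (dotrowC y).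
have -> : dotrow (x *m (A + B)) y =
    2 * dotrow (x *m A) y - dotrow (x *m (A - B)) y.
  by rewrite mulmxDr mulmxBr !dotrowDl dotrowNl; ring.
rewrite (dotrow_svd _ _ ABE) !minnn.
have trunc n (q : 'rV[R]_n) : (p <= n)%N ->
    \sum_(a < n) t a * (coef q a * coef q a) =
    \sum_(a < p) t a * (coef q a * coef q a).
  move=> pn; apply: (@sum_extend _ p n (fun a => t a * (coef q a * coef q a))) => //.
  by move=> a pa; rewrite tend // mul0r.
rewrite !trunc ?geq_minl ?geq_minr // -subr_ge0.
set F := \sum_(a < p) _; set F1 := \sum_(a < p) _; set F2 := \sum_(a < p) _.
have -> : F + (2 * dotrow (x *m A) y - F1) + (2 * dotrow (x *m A) y - F1 + F2) -
    4 * dotrow (x *m A) y = F + F2 - (F1 + F1) by ring.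
rewrite /F /F1 /F2 -!big_split -sumrB; apply: sumr_ge0 => a _ /=.
have := mulr_ge0 (t0 a) (sqr_ge0 (coef (x *m W) a - coef (y *m Z) a)); nra.
Qed.

Lemma mirsky (A B : 'M[R]_(n1, n2)) (s s' t : nat -> R) :
  is_svals A s -> is_svals B s' -> is_svals (A - B) t ->
  \sum_(i < p) `|s i - s' i| <= \sum_(i < p) t i.
Proof.
move=> As Bs' [t0 [tdec [tend [W [Z [W1 [Z1 ABE]]]]]]].
have [K KE] : exists K, K = mirsky_mx A B W Z t by eexists.
have KA x y : 4 * dotrow (x *m A) y <= dotrow (row_mx x y *m K) (row_mx x y).
  by rewrite KE; apply: mirsky_form_ge.
have KB x y : 4 * dotrow (x *m B) y <= dotrow (row_mx x y *m K) (row_mx x y).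
  rewrite KE mirsky_mxC; apply: mirsky_form_ge => //.
  by rewrite -opprB ABE !mulNmx.
have [U [d [U1 Kd dS]]] := symmetric_sorted_diagonalizable (mirsky_mx_sym A B W Z t).
rewrite -KE in Kd.
have trK : \tr K = 2 * \sum_(i < p) t i.
  rewrite KE mxtrace_block !tr_conj_rdiag //.
  by rewrite !(@sum_extend _ p) ?geq_minl ?geq_minr // mulr_natl mulr2n.
have trd : \tr K = \sum_(0 <= i < N) coef d i.
  rewrite Kd mxtrace_mulC mulmxA (mulmx1C U1) mul1mx mxtrace_diag big_mkord.
  by apply: eq_bigr => i _; rewrite coef_ord.
rewrite -(@ler_pM2l _ 2) // -trK trd.
(* As [2p <= N], the spectrum splits into the top [p], a middle range, and the bottom [p]; the last
   is counted from the end so that index [i] pairs with [N - i.+1]. *)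
have -> : \sum_(0 <= i < N) coef d i = \sum_(i < p) coef d i +
    \sum_(p <= i < N - p) coef d i + \sum_(i < p) coef d (N - i.+1).
  rewrite (big_cat_nat (n := p)) ?leq0n //=; last by lia.
  rewrite (big_cat_nat (m := p) (n := N - p)) /=; [|lia..].
  rewrite addrA big_mkord; congr (_ + _); rewrite big_nat_rev /=.
  rewrite -{1}[(N - p)%N]add0n big_addn (_ : (N - (N - p) = p)%N) ?big_mkord; last lia.
  by apply: eq_bigr => i _; congr coef; have := ltn_ord i; lia.
apply: (@le_trans _ _ (\sum_(i < p) coef d i + \sum_(i < p) coef d (N - i.+1))).
  rewrite mulr_sumr -big_split; apply: ler_sum => i _ /=.
  have ip := ltn_ord i.
  have := dilation_eigenvalue_ge U1 Kd dS KA As ip.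
  have := dilation_eigenvalue_ge U1 Kd dS KB Bs' ip.
  have jN : (N - i.+1 + i < N)%N by lia.
  have := dilation_eigenvalue_geN U1 Kd dS KA As (ltnW ip) jN.
  have := dilation_eigenvalue_geN U1 Kd dS KB Bs' (ltnW ip) jN.
  by case: (ler0P (s i - s' i)) => _; lra.
(* Middle eigenvalues are nonnegative: [p] constraints give the lower bound [-2 s_p = 0]. *)
rewrite addrAC lerDl big_nat; apply: sumr_ge0 => i ipN.
have := @dilation_eigenvalue_geN K A s U d p i U1 Kd dS KA As (leqnn _).
have [_ [_ [-> // _]]] := As.
by rewrite mulr0 oppr0; apply; lia.
Qed.
End Mirsky.

(** * Trace, Frobenius and nuclear norm estimates *)

Section Entries.
Variable R : rcfType.

Lemma mulmx_trE k l m (A : 'M[R]_(k, m)) (B : 'M_(l, m)) i j :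
  (A *m B^T) i j = dotrow (row i A) (row j B).
Proof. by rewrite dotrowE mxE; apply: eq_bigr => a _; rewrite !mxE. Qed.

(** Zero extension again, so that entries of square factors of sizes [n1] and [n2] share one index
    range. *)
Definition entry m n (A : 'M[R]_(m, n)) (i j : nat) : R :=
  if insub i is Some i' then coef (row i' A) j else 0.

Lemma entry_ord m n (A : 'M[R]_(m, n)) (i : 'I_m) j : entry A i j = coef (row i A) j.
Proof. by rewrite /entry valK. Qed.

Lemma entry_lt m n (A : 'M[R]_(m, n)) i j (im : (i < m)%N) (jn : (j < n)%N) :
  entry A i j = A (Ordinal im) (Ordinal jn).
Proof.
by rewrite (entry_ord A (Ordinal im)) coef_lt mxE.
Qed.

Lemma entry_tr m n (A : 'M[R]_(m, n)) i j : entry A^T j i = entry A i j.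
Proof.
have out k l (B : 'M[R]_(k, l)) a b : (k <= a)%N \/ (l <= b)%N -> entry B a b = 0.
  rewrite /entry; case: insubP => // a' a'k _ [ka|lb]; last exact: coef_default.
  by move: a'k; rewrite ltnNge ka.
have [im|mi] := ltnP i m; last by rewrite !out //; [left|right].
have [jn|nj] := ltnP j n; last by rewrite !out //; [right|left].
by rewrite !entry_lt mxE.
Qed.

Lemma coef_sum_sqr_le n (x : 'rV[R]_n) k : \sum_(a < k) coef x a ^+ 2 <= dotrow x x.
Proof.
rewrite (@sum_minn _ k n (fun a => coef x a ^+ 2)) => [|a na].
  rewrite (big_ord_widen_cond n xpredT (fun a => coef x a ^+ 2)) ?geq_minr //=.
  rewrite dotrow_coef big_mkcond; apply: ler_sum => a _.
  by case: ifP => _; rewrite -expr2 // sqr_ge0.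
by rewrite coef_default // expr0n.
Qed.

Lemma orthogonalmx_row_sqr_le n (G : 'M[R]_n) i k :
  orthogonalmx G -> \sum_(a < k) entry G i a ^+ 2 <= 1.
Proof.
move=> G1; rewrite /entry; case: insubP => [i' _ _|_].
  apply: le_trans (coef_sum_sqr_le _ _) _.
  by rewrite -mulmx_trE G1 mxE eqxx.
by rewrite big1 ?ler01 // => a _; rewrite expr0n.
Qed.

Lemma orthogonalmx_col_sqr_le n (G : 'M[R]_n) j k :
  orthogonalmx G -> \sum_(a < k) entry G a j ^+ 2 <= 1.
Proof.
move=> /orthogonalmx_tr /(@orthogonalmx_row_sqr_le _ _ j k).
by under eq_bigr do rewrite entry_tr.
Qed.

Lemma entry_mul_rdiag k m n l (A : 'M[R]_(k, m)) s (B : 'M_(n, l)) i j :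
  (i < k)%N -> (j < l)%N -> entry (A *m rdiag_mx m n s *m B) i j =
  \sum_(a < minn m n) s a * (entry A i a * entry B a j).
Proof.
move=> ik jl; rewrite entry_lt.
have -> : (A *m rdiag_mx m n s *m B) (Ordinal ik) (Ordinal jl) =
    dotrow (row (Ordinal ik) A *m rdiag_mx m n s) (row (Ordinal jl) B^T).
  by rewrite -{1}(trmxK B) mulmx_trE row_mul.
rewrite dotrow_rdiag; apply: eq_bigr => a _.
by rewrite -!entry_ord /= entry_tr.
Qed.

Lemma tr_rdiag_mul m n s (B : 'M[R]_(n, m)) :
  \tr (rdiag_mx m n s *m B) = \sum_(a < minn m n) s a * entry B a a.
Proof.
(* An identity factor on the left puts diagonal entries in the shape of [entry_mul_rdiag]; after
   exchanging sums it selects [a = b]. *)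
pose F a := \sum_(b < minn m n) s b * (entry (1%:M : 'M[R]_m) a b * entry B b a).
have -> : \tr (rdiag_mx m n s *m B) = \sum_(a < m) F a.
  apply: eq_bigr => a _; rewrite /F -entry_mul_rdiag // mul1mx.
  by rewrite entry_ord coef_ord [RHS]mxE.
rewrite exchange_big /=; apply: eq_bigr => b _.
have bm : (b < m)%N by have := ltn_ord b; lia.
rewrite (bigD1 (Ordinal bm)) //= entry_lt mxE eqxx mul1r big1 ?addr0 // => a.
by rewrite -val_eqE /= => /negPf ab; rewrite entry_lt mxE -val_eqE /= ab mul0r mulr0.
Qed.

Lemma frobnorm_sqr n1 n2 (H : 'M[R]_(n1, n2)) : frobnorm H ^+ 2 = \tr (H *m H^T).
Proof.
rewrite /frobnorm sqr_sqrtr; last first.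
  by apply: sumr_ge0 => i _; apply: sumr_ge0 => j _; apply: sqr_ge0.
apply: eq_bigr => i _; rewrite mxE; apply: eq_bigr => j _.
by rewrite mxE expr2.
Qed.

Lemma frobnorm_sqrD n1 n2 (X H : 'M[R]_(n1, n2)) :
  frobnorm (X + H) ^+ 2 = frobnorm X ^+ 2 + 2 * \tr (X *m H^T) + frobnorm H ^+ 2.
Proof.
rewrite !frobnorm_sqr raddfD /= mulmxDl !mulmxDr !mxtraceD.
have -> : \tr (H *m X^T) = \tr (X *m H^T).
  by rewrite -mxtrace_tr trmx_mul trmxK.
ring.
Qed.

Lemma frobnorm_sqr_eq0 n1 n2 (H : 'M[R]_(n1, n2)) : frobnorm H ^+ 2 = 0 -> H = 0.
Proof.
rewrite frobnorm_sqr => /eqP; rewrite /mxtrace psumr_eq0 => [/allP Hr|i _].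
  apply/row_matrixP => i; rewrite row0; apply/eqP; rewrite -dotrow_eq0.
  by have := Hr i (mem_index_enum _); rewrite /= mulmx_trE.
rewrite mulmx_trE; exact: dotrow_ge0.
Qed.

Lemma frobnorm_svals n1 n2 (H : 'M[R]_(n1, n2)) s : is_svals H s ->
  frobnorm H ^+ 2 = \sum_(i < minn n1 n2) s i ^+ 2.
Proof.
case=> _ [_ [_ [U [V [U1 [V1 ->]]]]]].
rewrite frobnorm_sqr !trmx_mul trmxK rdiag_mx_tr -!mulmxA (mulmxA V^T).
rewrite (mulmx1C V1) mul1mx mxtrace_mulC -!mulmxA.
rewrite (mulmx1C U1) mulmx1 tr_rdiag_mul; apply: eq_bigr => a _.
have [a1 a2] : (a < n1 /\ a < n2)%N by have := ltn_ord a; lia.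
by rewrite entry_lt mxE eqxx expr2.
Qed.

Lemma is_svalsN n1 n2 (H : 'M[R]_(n1, n2)) s : is_svals H s -> is_svals (- H) s.
Proof.
case=> s0 [sdec [send [U [V [U1 [V1 ->]]]]]].
do 3![split=> //]; exists (- U), V.
by rewrite /orthogonalmx linearN /= !mulNmx mulmxN opprK.
Qed.

(** Indices start at 0, so [s r] is the singular value of rank [r + 1]. Were it positive, inverting
    the first [r + 1] singular values would produce from [X] a partial identity of rank [r + 1]. *)
Lemma svals_rank n1 n2 (X : 'M[R]_(n1, n2)) s r : is_svals X s ->
  (\rank X <= r)%N -> s r = 0.
Proof.
case=> s0 [sdec [send [U [V [U1 [V1 XE]]]]]] rX.
have [pr|rp] := leqP (minn n1 n2) r; first exact: send.
apply/eqP; rewrite eq_le s0 andbT leNgt; apply/negP => sr.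
have [r1 r2] : (r < n1 /\ r < n2)%N by lia.
have : (\rank (pid_mx r.+1 : 'M[R]_(n1, n2)) <= r)%N; last first.
  by rewrite rank_pid_mx // ltnn.
suff -> : pid_mx r.+1 = U^T *m X *m (V *m diag_mx (\row_(j < n2)
    if (j <= r)%N then (s j)^-1 else 0)).
  apply: leq_trans (mxrankM_maxl _ _) _.
  by apply: leq_trans (mxrankM_maxr _ _) rX.
rewrite XE !mulmxA (mulmx1C U1) mul1mx -(mulmxA _ V^T) (mulmx1C V1) mulmx1.
apply/matrixP => i j; rewrite mul_mx_diag !mxE.
case: eqP => [ij|_] /=; last by rewrite mul0r.
rewrite -ij ltnS; case: ifP => ir; last by rewrite mulr0.
by rewrite mulfV // gt_eqF // (lt_le_trans sr) ?sdec.
Qed.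

Lemma sum_trunc_if p r (t : nat -> R) : (forall b, (p <= b)%N -> t b = 0) ->
  \sum_(b < p) (if (b < r)%N then t b else 0) = \sum_(b < r) t b.
Proof.
move=> tend; rewrite (@sum_minn _ r p) // minnC.
rewrite (@sum_minn _ p r (fun b => if (b < r)%N then t b else 0)); last first.
  by move=> b rb; rewrite ltnNge rb.
apply: eq_bigr => b _; suff -> : (b < r)%N by [].
by have := ltn_ord b; lia.
Qed.

(** Weights in [[0, 1]] of total at most [r] do best on the [r] largest terms. Subtracting [t r]
    from every term makes those before [r] nonnegative and the others nonpositive. *)
Lemma weighted_sum_le p r (t w : nat -> R) :
  (forall b, 0 <= t b) -> (forall a b, (a <= b)%N -> t b <= t a) ->
  (forall b, (p <= b)%N -> t b = 0) ->
  (forall b, 0 <= w b <= 1) -> \sum_(b < p) w b <= r%:R ->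
  \sum_(b < p) t b * w b <= \sum_(b < r) t b.
Proof.
move=> t0 tdec tend w01 wr.
have -> : \sum_(b < p) t b * w b = \sum_(b < p) (t b - t r) * w b +
    t r * \sum_(b < p) w b.
  by rewrite mulr_sumr -big_split; apply: eq_bigr => b _ /=; ring.
have le1 : t r * \sum_(b < p) w b <= t r * r%:R by rewrite ler_wpM2l.
suff le2 : \sum_(b < p) (t b - t r) * w b <= \sum_(b < r) t b - t r * r%:R.
  by apply: le_trans (lerD le2 le1) _; rewrite subrK.
have [pr|rp] := leqP p r.
  rewrite tend // mul0r subr0 (@sum_extend _ p r) //.
  apply: ler_sum => b _; rewrite subr0.
  by have /andP[_ w1] := w01 b; rewrite ler_piMr.
have -> : \sum_(b < r) t b - t r * r%:R = \sum_(b < r) (t b - t r).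
  by rewrite sumrB sumr_const card_ord mulr_natr.
rewrite (big_ord_widen_cond p xpredT (fun b => t b - t r)) 1?ltnW //=.
rewrite [X in _ <= X]big_mkcond; apply: ler_sum => b _.
have /andP[w0 w1] := w01 b; case: ltnP => br.
  by rewrite ler_piMr // subr_ge0 tdec // ltnW.
by rewrite mulr_le0_ge0 // subr_le0 tdec.
Qed.

(** A form of von Neumann's trace inequality. The trace is the sum of [s_a t_b g_ab f_ba] with [g],
    [f] entries of orthogonal matrices. Only [a < r] contributes, [s_a <= s_0], and
    [|g f| <= (g^2 + f^2) / 2]. Unit rows and columns bound each resulting weight [w b] by 1 and
    their total by [r], as [weighted_sum_le] requires. *)
Lemma trace_svals_le n1 n2 (X H : 'M[R]_(n1, n2)) s t (r : nat) :
  is_svals X s -> is_svals H t -> s r = 0 ->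
  `|\tr (X *m H^T)| <= s 0 * \sum_(b < r) t b.
Proof.
move=> [s0 [sdec [send [P [Q [P1 [Q1 XE]]]]]]] [t0 [tdec [tend [U [V [U1 [V1 HE]]]]]]] sr.
set p := minn n1 n2 in send tend.
pose g a b := entry (Q^T *m V) a b; pose f b a := entry (U^T *m P) b a.
have G1 : orthogonalmx (Q^T *m V) by apply/orthogonalmxM => //; apply: orthogonalmx_tr.
have F1 : orthogonalmx (U^T *m P) by apply/orthogonalmxM => //; apply: orthogonalmx_tr.
have -> : \tr (X *m H^T) =
    \sum_(a < p) s a * \sum_(b < p) t b * (g a b * f b a).
  rewrite XE HE !trmx_mul trmxK rdiag_mx_tr -!mulmxA mxtrace_mulC -!mulmxA.
  rewrite tr_rdiag_mul; apply: eq_bigr => a _; congr (_ * _).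
  have [a1 a2] : (a < n1 /\ a < n2)%N by have := ltn_ord a; lia.
  by rewrite !mulmxA -(mulmxA _ U^T) entry_mul_rdiag // minnC.
pose w b := \sum_(a < minn p r) (g a b ^+ 2 + f b a ^+ 2) / 2.
have wE b : w b = (\sum_(a < minn p r) g a b ^+ 2 + \sum_(a < minn p r) f b a ^+ 2) / 2.
  by rewrite /w -mulr_suml big_split.
have w01 b : 0 <= w b <= 1.
  apply/andP; split.
    by apply: sumr_ge0 => a _; rewrite mulr_ge0 ?invr_ge0 ?addr_ge0 ?sqr_ge0 ?ler0n.
  have := orthogonalmx_col_sqr_le b (minn p r) G1.
  by have := orthogonalmx_row_sqr_le b (minn p r) F1; rewrite wE; lra.
have wr : \sum_(b < p) w b <= r%:R.
  rewrite exchange_big /=; apply: (@le_trans _ _ (\sum_(a < minn p r) 1)); last first.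
    by rewrite sumr_const card_ord ler_nat geq_minr.
  apply: ler_sum => a _; rewrite -mulr_suml big_split /=.
  have := orthogonalmx_row_sqr_le a p G1.
  by have := orthogonalmx_col_sqr_le a p F1; lra.
apply: le_trans (ler_wpM2l (s0 0) (weighted_sum_le t0 tdec tend w01 wr)).
rewrite (@sum_minn _ p r (fun a => s a * \sum_(b < p) t b * (g a b * f b a))); last first.
  by move=> a ra; rewrite (_ : s a = 0) ?mul0r //; apply/eqP; rewrite eq_le s0 -sr sdec.
have -> : \sum_(b < p) t b * w b =
    \sum_(a < minn p r) \sum_(b < p) t b * ((g a b ^+ 2 + f b a ^+ 2) / 2).
  by rewrite exchange_big; apply: eq_bigr => b _; rewrite mulr_sumr.
apply: le_trans (ler_norm_sum _ _ _) _; rewrite mulr_sumr; apply: ler_sum => a _.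
rewrite normrM ger0_norm //; apply: ler_pM => //; first exact: sdec.
apply: le_trans (ler_norm_sum _ _ _) _; apply: ler_sum => b _.
rewrite normrM ger0_norm // ler_wpM2l //.
have := sqr_ge0 (g a b - f b a); have := sqr_ge0 (g a b + f b a).
by case: (ler0P (g a b * f b a)) => _; nra.
Qed.

(** Cauchy-Schwarz against the all-ones vector; the inductive step expands the sum of
    [(x_i - x_r)^2]. *)
Lemma sum_sqr_le r (x : nat -> R) :
  (\sum_(i < r) x i) ^+ 2 <= r%:R * \sum_(i < r) x i ^+ 2.
Proof.
elim: r => [|r IHr]; first by rewrite !big_ord0 mulr0 expr0n.
rewrite !big_ord_recr /= -natr1.
have : 0 <= \sum_(i < r) (x i - x r) ^+ 2 by apply: sumr_ge0 => i _; apply: sqr_ge0.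
have -> : \sum_(i < r) (x i - x r) ^+ 2 =
    \sum_(i < r) x i ^+ 2 - 2 * x r * \sum_(i < r) x i + r%:R * x r ^+ 2.
  have -> : r%:R * x r ^+ 2 = \sum_(i < r) x r ^+ 2.
    by rewrite sumr_const card_ord mulr_natl.
  rewrite mulr_sumr -sumrB -big_split; apply: eq_bigr => i _ /=; ring.
lra.
Qed.

Lemma nucnorm_tail n1 n2 (H : 'M[R]_(n1, n2)) r :
  nucnorm H = \sum_(i < r) sv H i + \sum_(r <= i < minn n1 n2) sv H i.
Proof.
have [_ [_ [send _]]] := svP H; rewrite /nucnorm.
have [pr|rp] := leqP (minn n1 n2) r.
  by rewrite [X in _ + X]big_geq // addr0 (sum_extend pr).
rewrite -!(big_mkord xpredT (sv H)) (big_cat_nat (n := r)) //; exact: ltnW.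
Qed.

Lemma head_svals_le n1 n2 (H : 'M[R]_(n1, n2)) (r : nat) (k q : R) :
  0 <= k -> k ^+ 2 * r%:R <= q -> Num.sqrt q * frobnorm H <= nucnorm H ->
  k * \sum_(i < r) sv H i <= nucnorm H.
Proof.
move=> k0 kq; apply: le_trans.
have svH := svP H; have [s0 [_ [send _]]] := svH.
have S0 : 0 <= \sum_(i < r) sv H i by apply: sumr_ge0.
have q0 : 0 <= q by apply: le_trans kq; rewrite mulr_ge0 ?sqr_ge0.
rewrite -ler_sqr ?nnegrE ?mulr_ge0 ?sqrtr_ge0 // !exprMn sqr_sqrtr //.
have F0 := sqr_ge0 (frobnorm H).
apply: le_trans (ler_wpM2r F0 kq); rewrite -[X in _ <= X]mulrA ler_wpM2l ?sqr_ge0 //.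
apply: le_trans (sum_sqr_le _ _) _; rewrite ler_wpM2l ?ler0n //.
rewrite (frobnorm_svals svH) -(@sum_trunc_if (minn n1 n2) r (fun i => sv H i ^+ 2)).
  by apply: ler_sum => i _; case: ifP => _; rewrite ?sqr_ge0.
by move=> b /send ->; rewrite expr0n.
Qed.

(** Mirsky is applied to [X] and [- H], the latter having the singular values of [H]. Below [r] one
    uses [|s - t| >= s + t - 2t]; from [r] on, the singular values of [X] vanish and the term is
    [t]. *)
Lemma nucnorm_add_ge n1 n2 (X H : 'M[R]_(n1, n2)) r : (\rank X <= r)%N ->
  nucnorm X + nucnorm H - 2 * \sum_(i < r) sv H i <= nucnorm (X + H).
Proof.
move=> rX; have svX := svP X; have svH := svP H.
have sr := svals_rank svX rX; have [s0 [sdec _]] := svX.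
have [t0 [_ [tend _]]] := svH.
have svXH : is_svals (X - - H) (sv (X + H)) by rewrite opprK; apply: svP.
apply: le_trans (mirsky svX (is_svalsN svH) svXH).
rewrite -(@sum_trunc_if (minn n1 n2) r) // mulr_sumr -big_split -sumrB.
apply: ler_sum => i _ /=; case: ltnP => ir.
  by have := ler_norm (sv X i - sv H i); lra.
have -> : sv X i = 0 by apply/eqP; rewrite eq_le s0 -sr sdec.
by rewrite sub0r normrN mulr0 subr0 add0r ger0_norm.
Qed.

End Entries.

Theorem mainTheorem12 (R : rcfType) (n1 n2 m r : nat)
    (A : {linear 'M[R]_(n1, n2) -> 'cV[R]_m}) (Delta c alpha : R) :
  0 < Delta ->
  (forall H : 'M[R]_(n1, n2), A H = 0 -> H != 0 ->
     Num.sqrt (m%:R / Delta) * frobnorm H <= nucnorm H) ->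
  0 < c -> 0 < alpha ->
  (2 + c / alpha) ^+ 2 * r%:R * Delta <= m%:R ->
  (forall H : 'M[R]_(n1, n2), A H = 0 ->
     (1 + c / alpha) * (\sum_(i < r) sv H i)
       <= \sum_(r <= i < minn n1 n2) sv H i) /\
  (forall X0 : 'M[R]_(n1, n2), (\rank X0 <= r)%N -> specnorm X0 = c ->
     unique_solution_N2 A (A X0) alpha X0).
Proof.
move=> D0 Hnull c0 a0 rm.
have k0 : 0 < c / alpha by rewrite divr_gt0.
have key H : A H = 0 -> (2 + c / alpha) * \sum_(i < r) sv H i <= nucnorm H.
  move=> AH; apply: (@head_svals_le _ _ _ _ _ _ (m%:R / Delta)).
  - by rewrite addr_ge0 ?ler0n ?ltW.
  - by rewrite ler_pdivlMr.
  (* The null space hypothesis excludes [H = 0], which is checked directly. *)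
  have [H0|] := eqVneq H 0; last exact: Hnull.
  have -> : frobnorm H = 0.
    by apply/eqP; rewrite -sqrf_eq0 frobnorm_sqr H0 mul0mx mxtrace0.
  by rewrite mulr0; apply: sumr_ge0 => i _; case: (svP H).
split=> [H AH|X0 rX Xc].
  by have := key H AH; rewrite (nucnorm_tail H r); lra.
(* With [T] the sum of the top [r] singular values of [H], the nuclear norm grows by at least
   [|H|_* - 2T >= (c/alpha) T], while the Frobenius cross term loses at most [(c/alpha) T]. These
   cancel and the quadratic term remains. *)
have gap Y : A Y = A X0 ->
    N2obj alpha X0 + (2 * alpha)^-1 * frobnorm (Y - X0) ^+ 2 <= N2obj alpha Y.
  move=> AY; have [H HE] : exists H, H = Y - X0 by eexists.
  have AH : A H = 0 by rewrite HE linearB /= AY subrr.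
  have YE : Y = X0 + H by rewrite HE addrC subrK.
  rewrite -HE YE /N2obj frobnorm_sqrD.
  have nuc := nucnorm_add_ge H rX.
  have := trace_svals_le (svP X0) (svP H) (svals_rank (svP X0) rX).
  rewrite -/(specnorm X0) Xc ler_norml => /andP[trXH _].
  have u0 : 0 < alpha^-1 by rewrite invr_gt0.
  have := ler_wpM2l (ltW u0) trXH.
  by have := key H AH; move: nuc; rewrite invfM; lra.
have gapF_ge0 Y : 0 <= (2 * alpha)^-1 * frobnorm (Y - X0) ^+ 2.
  by rewrite mulr_ge0 ?sqr_ge0 // invr_ge0 mulr_ge0 // ltW.
split; first by split=> // Y /gap; apply: le_trans; rewrite lerDl.
move=> Y [AY /(_ X0 erefl) YX0].
(* Optimality of [Y] makes the quadratic gap nonpositive, so it is zero and [Y = X0]. *)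
have := le_trans (gap Y AY) YX0; rewrite gerDl => gap0.
have /eqP : (2 * alpha)^-1 * frobnorm (Y - X0) ^+ 2 = 0 by apply: le_anti; rewrite gap0 gapF_ge0.
rewrite mulf_eq0 invr_eq0 mulf_eq0 pnatr_eq0 (gt_eqF a0) /= => /eqP /frobnorm_sqr_eq0.
by move/eqP; rewrite subr_eq0 => /eqP.
Qed.
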